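(* Consider a two-action ($\mathcal{A}=\{1,2\}$) infinite-horizon discounted-cost POMDP with states $\mathbb{X}=\{1,\dots,X\}$, transition matrices $P_1,P_2$, observation matrices/kernels $B_1,B_2$, cost vectors $c_1,c_2\in\mathbb{R}^X$ and discount factor $\rho\in[0,1)$, satisfying the standing assumptions (i)–(v) listed in the context. For $g,f\in\mathbb{R}^X$ and $a\in\{1,2\}$ put $\overline{C}_a^{\,g}=c_a+(I-\rho P_a)g$ and $\underline{C}_a^{\,f}=c_a+(I-\rho P_a)f$, and let $$S_g=\{g\in\mathbb{R}^X:\ \overline{C}^{\,g}_a(i)\le\overline{C}^{\,g}_a(i+1)\ \ \forall a\in\{1,2\},\ i=1,\dots,X-1\},$$ $$S_f=\{f\in\mathbb{R}^X:\ \underline{C}^{\,f}_a(i)\ge\underline{C}^{\,f}_a(i+1)\ \ \forall a\in\{1,2\},\ i=1,\dots,X-1\}.$$ Define the myopic policies $\overline{\mu}_g(\pi)=\operatorname{argmin}_{a}(\overline{C}^{\,g}_a)'\pi$ and $\underline{\mu}_f(\pi)=\operatorname{argmin}_{a}(\underline{C}^{\,f}_a)'\pi$, and the overlapping region $$\Pi_O(g,f)=\{\pi\in\Pi:\ \overline{\mu}_g(\pi)=\underline{\mu}_f(\pi)=\mu^*(\pi)\},$$ where $\mu^*$ is the optimal policy. Assume there exist fixed vectors $g^*\in S_g$ and $f^*\in S_f$ such that, componentwise, $$(P_2-P_1)g^*\preceq(P_2-P_1)g\quad\forall g\in S_g,\qquad (P_1-P_2)f^*\preceq(P_1-P_2)f\quad\forall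 f\in S_f .$$ Then using $g^*$ and $f^*$ to construct the myopic policies maximizes the volume of the overlapping region: $$\operatorname{vol}(\Pi_O(g^*,f^* ))\ge\operatorname{vol}(\Pi_O(g,f))\qquad\text{for all } g\in S_g,\ f\in S_f .$$
   Context: Prime denotes transpose; $I$ is the $X\times X$ identity; for vectors $u,v\in\mathbb{R}^X$, $u\preceq v$ means $u_i\le v_i$ for all $i$. The belief space is the simplex $\Pi=\{\pi\in\mathbb{R}^X:\pi(i)\in[0,1],\ \sum_{i=1}^X\pi(i)=1\}$, and $\operatorname{vol}$ is $(X-1)$-dimensional Lebesgue volume on $\Pi$. For each action $a$, $P_a=[p^a_{ij}]$ is a stochastic matrix with $p^a_{ij}=\mathbb{P}(x_{k+1}=j\mid x_k=i,a_k=a)$, and $B_a=[b^a_{x,y}]$ with $b^a_{x,y}=\mathbb{P}(y_{k+1}=y\mid x_{k+1}=x,a_k=a)$ when the observation space $\mathbb{Y}=\{1,\dots,Y\}$ is finite, or the conditional density of $y_{k+1}$ when $\mathbb{Y}\subset\mathbb{R}$ is continuous (sums over $y$ are then read as integrals, and second-order minors of $B_a$ are $b^a_{i,y}b^a_{j,z}-b^a_{i,z}b^a_{j,y}$ for $i<j$, $y<z$). With $B^a_y=\operatorname{diag}(b^a_{1,y},\dots,b^a_{X,y})$ and $\mathbf{1}$ the all-ones vector, let $\sigma(\pi,y,a)=\mathbf{1}'B^a_yP_a'\pi$ and $T(\pi,y,a)=B^a_yP_a'\pi/\sigma(\pi,y,a)$. The value function $V$ is the bounded solution on $\Pi$ of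 $V(\pi)=\min_{a}Q(\pi,a)$, with $Q(\pi,a)=c_a'\pi+\rho\sum_{y\in\mathbb{Y}}V(T(\pi,y,a))\sigma(\pi,y,a)$ (terms with $\sigma=0$ taken as $0$); the optimal policy is $\mu^*(\pi)=\operatorname{argmin}_aQ(\pi,a)$. Throughout, $\operatorname{argmin}$ over actions means the smallest minimizing action. Standing assumptions: (i) There exists $g\in\mathbb{R}^X$ such that $c_a+(I-\rho P_a)g$ has strictly increasing components for each $a\in\{1,2\}$. (ii) There exists $f\in\mathbb{R}^X$ such that $c_a+(I-\rho P_a)f$ has strictly decreasing components for each $a\in\{1,2\}$. (iii) $P_a$ and $B_a$, $a\in\{1,2\}$, are totally positive of order 2 (all second-order minors are nonnegative). (iv) For all $m,n\in\mathbb{X}$, $j\in\{1,\dots,X-1\}$, $y\in\mathbb{Y}$: $\gamma^{j,y}_{mn}+\gamma^{j,y}_{nm}\ge0$, where $\gamma^{j,y}_{mn}=b^1_{j,y}b^2_{j+1,y}p^1_{m,j}p^2_{n,j+1}-b^1_{j+1,y}b^2_{j,y}p^1_{m,j+1}p^2_{n,j}$. (v) For all $i\in\mathbb{X}$ and $\bar y\in\mathbb{Y}$: $\sum_{y\le\bar y}\sum_{j\in\mathbb{X}}[p^1_{i,j}b^1_{j,y}-p^2_{i,j}b^2_{j,y}]\ge0$. *)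

(* Defs.v *)
From HB Require Import structures.
From mathcomp Require Import all_boot all_order all_algebra.
From mathcomp Require Import all_classical all_reals all_analysis.
Set Implicit Arguments.
Unset Strict Implicit.
Unset Printing Implicit Defensive.
Import Order.TTheory GRing.Theory Num.Theory.
Import numFieldNormedType.Exports.
Local Open Scope classical_set_scope.
Local Open Scope ring_scope.

(** The [X] states are the elements of ['I_n.+1] (so [X = n.+1]), numbered
    from 0. *)

(** The actions 1 and 2 are the elements 0 and 1 of ['I_2]. *)
Definition act1 : 'I_2 := ord0.
Definition act2 : 'I_2 := ord_max.

(** Smallest minimizing action: ties are resolved in favour of action 1. *)
Definition argmin (R : realType) (q : 'I_2 -> R) : 'I_2 :=
  if q act1 <= q act2 then act1 else act2.

(** Observations are real numbers in both cases: [FinObs Y] stands for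
    {1, ..., Y}, and [ContObs D] for the subset [D] of the reals, the observation
    law then being given by densities with respect to Lebesgue measure. *)
Inductive obs_space (R : realType) : Type :=
| FinObs of nat
| ContObs of set R.

Section observations.
Variables (R : realType) (O : obs_space R).

Definition obs_set : set R :=
  match O with
  | FinObs Y => [set y | exists2 k : nat, (1 <= k <= Y)%N & y = k%:R]
  | ContObs D => D
  end.

Definition obs_space_wf : Prop :=
  match O with
  | FinObs _ => True
  | ContObs D => measurable D
  end.

(** The sum (resp. Lebesgue integral) of [f] over the observations lying in
    [A]. *)
Definition obs_sum (A : set R) (f : R -> R) : R :=
  match O with
  | FinObs Y => \sum_(1 <= k < Y.+1 | k%:R \in A) f k%:R
  | ContObs D => \int[lebesgue_measure]_(y in D `&` A) f y
  end.

(** [obs_sum] is meaningful: no condition for a finite sum, Lebesgue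
    integrability otherwise. *)
Definition obs_summable (f : R -> R) : Prop :=
  match O with
  | FinObs _ => True
  | ContObs D => lebesgue_measure.-integrable D (EFin \o f)
  end.

(** A probability mass function (resp. density) on the observation space. *)
Definition obs_law (b : R -> R) : Prop :=
  [/\ forall y, obs_set y -> 0 <= b y, obs_summable b & obs_sum setT b = 1].

End observations.

Section pomdp.
Variables (R : realType) (n : nat).
Variables (O : obs_space R).
(** [P a i j = p^a_{ij}] and [B a i y = b^a_{i,y}]. *)
Variables (P : 'I_2 -> 'M[R]_n.+1) (B : 'I_2 -> 'I_n.+1 -> R -> R).
Variables (c : 'I_2 -> 'cV[R]_n.+1) (rho : R).

Definition belief : set 'cV[R]_n.+1 :=
  [set p | (forall i, 0 <= p i 0 <= 1) /\ \sum_i p i 0 = 1].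

Definition stochastic (M : 'M[R]_n.+1) : Prop :=
  (forall i j, 0 <= M i j) /\ (forall i, \sum_j M i j = 1).

(** [B^a_y P_a' pi] *)
Definition unnorm_filter (p : 'cV[R]_n.+1) (y : R) (a : 'I_2) : 'cV[R]_n.+1 :=
  diag_mx (\row_i B a i y) *m ((P a)^T *m p).

Definition sigma (p : 'cV[R]_n.+1) (y : R) (a : 'I_2) : R :=
  ((const_mx 1 : 'rV[R]_n.+1) *m unnorm_filter p y a) 0 0.

Definition posterior (p : 'cV[R]_n.+1) (y : R) (a : 'I_2) : 'cV[R]_n.+1 :=
  (sigma p y a)^-1 *: unnorm_filter p y a.

(** When [sigma p y a = 0] this is [V 0 * 0 = 0], since [0^-1 = 0]. *)
Definition next_value (V : 'cV[R]_n.+1 -> R) (p : 'cV[R]_n.+1) (a : 'I_2)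
  (y : R) : R := V (posterior p y a) * sigma p y a.

Definition Qfun (V : 'cV[R]_n.+1 -> R) (p : 'cV[R]_n.+1) (a : 'I_2) : R :=
  ((c a)^T *m p) 0 0 + rho * obs_sum O setT (next_value V p a).

(** [V] is the bounded solution of Bellman's equation on the belief simplex.
    For continuous observations the integrals in the equation are required to
    exist, which makes the solution unique on the simplex. *)
Definition is_value_function (V : 'cV[R]_n.+1 -> R) : Prop :=
  [/\ exists K, forall p, belief p -> `|V p| <= K,
      forall p a, belief p -> obs_summable O (next_value V p a)
    & forall p, belief p -> V p = Num.min (Qfun V p act1) (Qfun V p act2)].

Definition optimal_policy (V : 'cV[R]_n.+1 -> R) (p : 'cV[R]_n.+1) : 'I_2 :=
  argmin (Qfun V p).

(** [c_a + (I - rho P_a) h]: this is the upper transformed cost when [h] is a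
    vector [g], and the lower one when [h] is a vector [f]. *)
Definition tcost (h : 'cV[R]_n.+1) (a : 'I_2) : 'cV[R]_n.+1 :=
  c a + (1%:M - rho *: P a) *m h.

Definition myopic (h p : 'cV[R]_n.+1) : 'I_2 :=
  argmin (fun a => ((tcost h a)^T *m p) 0 0).

Definition S_g : set 'cV[R]_n.+1 :=
  [set g | forall a (i j : 'I_n.+1), j = i.+1 :> nat ->
     tcost g a i 0 <= tcost g a j 0].

Definition S_f : set 'cV[R]_n.+1 :=
  [set f | forall a (i j : 'I_n.+1), j = i.+1 :> nat ->
     tcost f a i 0 >= tcost f a j 0].

Definition overlap (V : 'cV[R]_n.+1 -> R) (g f : 'cV[R]_n.+1) :
    set 'cV[R]_n.+1 :=
  [set p | [/\ belief p, myopic g p = myopic f p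
             & myopic f p = optimal_policy V p]].

Definition strictly_increasing (v : 'cV[R]_n.+1) : Prop :=
  forall i j : 'I_n.+1, (i < j)%N -> v i 0 < v j 0.

Definition strictly_decreasing (v : 'cV[R]_n.+1) : Prop :=
  forall i j : 'I_n.+1, (i < j)%N -> v j 0 < v i 0.

Definition TP2_mx (M : 'M[R]_n.+1) : Prop :=
  forall i j k l : 'I_n.+1, (i < j)%N -> (k < l)%N ->
    0 <= M i k * M j l - M i l * M j k.

Definition TP2_obs (b : 'I_n.+1 -> R -> R) : Prop :=
  forall (i j : 'I_n.+1) y z, (i < j)%N -> obs_set O y -> obs_set O z ->
    y < z -> 0 <= b i y * b j z - b i z * b j y.

(** [gamma j j' y m n], to be used with [j' = j + 1]. *)
Definition gamma (j j' : 'I_n.+1) (y : R) (k l : 'I_n.+1) : R :=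
  B act1 j y * B act2 j' y * P act1 k j * P act2 l j'
  - B act1 j' y * B act2 j y * P act1 k j' * P act2 l j.

Definition gamma_copositive : Prop :=
  forall (k l j j' : 'I_n.+1) y, j' = j.+1 :> nat -> obs_set O y ->
    0 <= gamma j j' y k l + gamma j j' y l k.

Definition obs_dominance : Prop :=
  forall (i : 'I_n.+1) ybar, obs_set O ybar ->
    0 <= obs_sum O [set y | y <= ybar] (fun y =>
           \sum_j (P act1 i j * B act1 j y - P act2 i j * B act2 j y)).

End pomdp.

Section volume.
Variable R : realType.

Definition box (n : nat) (a b : 'cV[R]_n) : set 'cV[R]_n :=
  [set v | forall i, a i 0 <= v i 0 <= b i 0].

(** [n]-dimensional Lebesgue (outer) measure: the infimum of the total volumes
    of the countable covers by closed boxes.  The index set [D] may be finite or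
    empty, so that in dimension 0 this is the counting measure.  On Lebesgue
    measurable sets this is Lebesgue measure, and it is defined for all sets,
    like [lebesgue_measure] on the real line. *)
Definition lebesgue_vol (n : nat) (A : set 'cV[R]_n) : \bar R :=
  ereal_inf [set s | exists (D : set nat) (a b : nat -> 'cV[R]_n),
    [/\ forall k i, a k i 0 <= b k i 0,
        A `<=` \bigcup_(k in D) box (a k) (b k)
      & s = \esum_(k in D) (\prod_i (b k i 0 - a k i 0))%:E]].

(** The simplex is charted by its first [n = X - 1] coordinates, the last one
    being determined by them; another chart, or the Euclidean surface measure,
    would change this volume only by a constant factor. *)
Definition vol (n : nat) (A : set 'cV[R]_n.+1) : \bar R :=
  lebesgue_vol [set row' ord_max p | p in A].

End volume.

(* Main.v *)
Require Import Defs.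
From mathcomp Require Import all_boot all_order all_algebra.
From mathcomp Require Import all_classical all_reals all_analysis.
From mathcomp Require Import ring.
Import Order.TTheory GRing.Theory Num.Theory.
Import numFieldNormedType.Exports.
Local Open Scope classical_set_scope.
Local Open Scope ring_scope.

(** Only the difference of the two transformed costs matters for a myopic
    policy, and in it the identity matrix cancels:
      [tcost h 1 - tcost h 2 = (c_1 - c_2) + rho (P_2 - P_1) h].
    A componentwise smaller [(P_2 - P_1) h] thus makes action 1 the myopic choice
    at more beliefs.  Minimality of [gstar] enlarges the region where the upper
    policy plays 1, and minimality of [(P_1 - P_2) fstar] enlarges the region
    where the lower policy plays 2.

    Enlarging both regions could only hurt where they meet, and for [gstar] and
    [fstar] they are disjoint.  Indeed [gstar - fstar] is a recession direction
    of [S_g]: [(I - rho P_a) (gstar - fstar)] is the increasing transformed cost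
    of [gstar] minus the decreasing one of [fstar].  So [gstar + (gstar - fstar)] lies in [S_g], and comparing it with the
    minimal [gstar] gives [(P_2 - P_1) fstar <= (P_2 - P_1) gstar]: wherever the
    upper policy of [gstar] plays 1, so does the lower policy of [fstar].

    If the policies of [g] and [f] agree at a belief, on either action, then
    those of [gstar] and [fstar] agree there on the same action.  If this action
    is optimal for one pair it is optimal for the other, so the overlap for [g]
    and [f] is contained in the one for [gstar] and [fstar], and volume is
    monotone. *)

Section MyopicPolicies.
Context {R : realType} {n : nat}.
Context {P : 'I_2 -> 'M[R]_n.+1} {c : 'I_2 -> 'cV[R]_n.+1} {rho : R}.

Lemma tcost_diff (h : 'cV[R]_n.+1) :
  tcost P c rho h act1 - tcost P c rho h act2 =
  c act1 - c act2 + rho *: ((P act2 - P act1) *m h).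
Proof.
rewrite /tcost !mulmxBl !mul1mx -!scalemxAl scalerBr.
by apply/matrixP => i j; rewrite !mxE; ring.
Qed.

Lemma tcost_extrapolate (g f : 'cV[R]_n.+1) a :
  tcost P c rho (g + (g - f)) a =
  tcost P c rho g a + (tcost P c rho g a - tcost P c rho f a).
Proof.
rewrite /tcost !(mulmxDr, mulmxN).
by apply/matrixP => i j; rewrite !mxE; ring.
Qed.

(** The transformed cost is affine in [h], so stepping from [f] through [g] and
    as far again adds to the increasing cost of [g] the difference of an
    increasing and a decreasing vector. *)
Lemma S_g_extrapolate {g f : 'cV[R]_n.+1} :
  S_g P c rho g -> S_f P c rho f -> S_g P c rho (g + (g - f)).
Proof.
move=> Sg Sf a i j ij; rewrite !tcost_extrapolate.
have Sg_ij := Sg a i j ij; have Sf_ij := Sf a i j ij.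
move: (tcost P c rho g a) (tcost P c rho f a) Sg_ij Sf_ij => u v uij vij.
by rewrite !mxE; apply: lerD => //; exact: lerB.
Qed.

Lemma myopic_act1 (h p : 'cV[R]_n.+1) :
  (myopic P c rho h p == act1) =
  (((tcost P c rho h act1 - tcost P c rho h act2)^T *m p) 0 0 <= 0).
Proof.
rewrite linearB /= mulmxBl !mxE subr_le0 /myopic /argmin !mxE.
by case: ifP.
Qed.

(** Beliefs have nonnegative entries, so a componentwise smaller
    [(P_2 - P_1) h] makes action 1 comparatively cheaper at each of them. *)
Lemma myopic_act1_mono {h k p : 'cV[R]_n.+1} :
  0 <= rho -> belief p ->
  (forall i, ((P act2 - P act1) *m h) i 0 <= ((P act2 - P act1) *m k) i 0) ->
  myopic P c rho k p = act1 -> myopic P c rho h p = act1.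
Proof.
move=> rho0 [p01 _] hk /eqP; rewrite myopic_act1 => k0.
apply/eqP; rewrite myopic_act1; apply: le_trans k0.
rewrite !tcost_diff [leLHS]mxE [leRHS]mxE; apply: ler_sum => i _.
have /andP[pi0 _] := p01 i.
rewrite ler_wpM2r // mxE [leRHS]mxE mxE [leRHS]mxE lerD2l.
by rewrite [leLHS]mxE [leRHS]mxE ler_wpM2l.
Qed.

End MyopicPolicies.

Lemma act2P {a : 'I_2} : a <> act1 -> a = act2.
Proof. by case: a => [[|[|m]] lt_a] // ne; [case: ne|]; apply: val_inj. Qed.

Lemma le_vol {R : realType} {n : nat} (A C : set 'cV[R]_n.+1) :
  A `<=` C -> (vol A <= vol C)%E.
Proof.
move=> AC; apply: ereal_inf_le_tmp => s [D [a [b [ab cov ->]]]].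
exists D, a, b; split=> //.
exact: subset_trans (image_subset _ AC) cov.
Qed.

Theorem theorem2 (R : realType) (n : nat) (O : obs_space R)
  (P : 'I_2 -> 'M[R]_n.+1) (B : 'I_2 -> 'I_n.+1 -> R -> R)
  (c : 'I_2 -> 'cV[R]_n.+1) (rho : R) (V : 'cV[R]_n.+1 -> R)
  (hO : obs_space_wf O)
  (hP : forall a, stochastic (P a))
  (hB : forall a i, obs_law O (B a i))
  (hrho : 0 <= rho < 1)
  (hV : is_value_function O P B c rho V)
  (h_i : exists g : 'cV[R]_n.+1, forall a,
      strictly_increasing (c a + (1%:M - rho *: P a) *m g))
  (h_ii : exists f : 'cV[R]_n.+1, forall a,
      strictly_decreasing (c a + (1%:M - rho *: P a) *m f))
  (h_iii : forall a, TP2_mx (P a) /\ TP2_obs O (B a))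
  (h_iv : gamma_copositive O P B)
  (h_v : obs_dominance O P B)
  (gstar fstar : 'cV[R]_n.+1)
  (hgS : S_g P c rho gstar) (hfS : S_f P c rho fstar)
  (hg : forall g, S_g P c rho g -> forall i,
      ((P act2 - P act1) *m gstar) i 0 <= ((P act2 - P act1) *m g) i 0)
  (hf : forall f, S_f P c rho f -> forall i,
      ((P act1 - P act2) *m fstar) i 0 <= ((P act1 - P act2) *m f) i 0) :
  forall g f : 'cV[R]_n.+1, S_g P c rho g -> S_f P c rho f ->
    (vol (overlap O P B c rho V g f)
       <= vol (overlap O P B c rho V gstar fstar))%E.
Proof.
move=> g f Sg Sf; have /andP[rho0 _] := hrho.
have gf i : ((P act2 - P act1) *m fstar) i 0
         <= ((P act2 - P act1) *m gstar) i 0.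
  have := hg _ (S_g_extrapolate hgS hfS) i; rewrite mulmxDr mulmxBr.
  move: (_ *m gstar) (_ *m fstar) => u v.
  by rewrite !mxE lerDl subr_ge0.
have ffstar i : ((P act2 - P act1) *m f) i 0
             <= ((P act2 - P act1) *m fstar) i 0.
  have := hf _ Sf i; rewrite -(opprB (P act2)) !mulNmx.
  by move: (_ *m fstar) (_ *m f) => u v; rewrite !mxE lerN2.
apply: le_vol => p [bp agree optimal].
suff [eg ef] : myopic P c rho gstar p = myopic P c rho f p /\
               myopic P c rho fstar p = myopic P c rho f p.
  by split; rewrite ?eg ?ef.
have [f1 | f_neq1] := eqVneq (myopic P c rho f p) act1.
  have gstar1 : myopic P c rho gstar p = act1.
    by apply: (myopic_act1_mono rho0 bp (hg _ Sg)); rewrite agree.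
  by rewrite f1; split=> //; exact: (myopic_act1_mono rho0 bp gf).
have fstar_neq1 : myopic P c rho fstar p <> act1.
  by move=> fstar1; case/eqP: f_neq1; exact: (myopic_act1_mono rho0 bp ffstar).
have gstar_neq1 : myopic P c rho gstar p <> act1.
  by move=> gstar1; apply: fstar_neq1; exact: (myopic_act1_mono rho0 bp gf).
by rewrite (act2P gstar_neq1) (act2P fstar_neq1) (act2P (elimN eqP f_neq1)).
Qed.
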